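(* Let $A\in\mathbb{R}^{n\times n}$ be symmetric positive definite, let $[\lambda_{\min},\lambda_{\max}]$ with $\lambda_{\min}<\lambda_{\max}$ be an interval containing the spectrum of $A$, let $r_0\in\mathbb{R}^n$ be nonzero, and let $s\ge1$. Let $S_s$, the Gram matrices $W^{(0)}=S_s^\top S_s$ and $W^{(A)}=S_s^\top A S_s$, and the moments $\mu_p^{(0)},\mu_p^{(A)}$ ($p\ge0$) be as defined in the context. Then for $\star\in\{0,A\}$ the entries of the corresponding Gram matrix satisfy $$W^{(\star)}_{ij}=\frac12\left(\mu_{i+j-2}^{(\star)}+\mu_{|i-j|}^{(\star)}\right),\qquad 1\le i,j\le s .$$ Moreover, both $W^{(0)}$ and $W^{(A)}$ are symmetric positive semidefinite. If $S_s$ has full column rank, then both matrices are symmetric positive definite.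
   Context: $T_j$ denotes the Chebyshev polynomial of the first kind of degree $j$. The interval $[\lambda_{\min},\lambda_{\max}]$ is a scaling interval containing the spectrum of $A$ (its endpoints need not be eigenvalues). Define $$\widehat A=\frac{2A-(\lambda_{\max}+\lambda_{\min})I}{\lambda_{\max}-\lambda_{\min}},\qquad S_s:=\bigl[T_0(\widehat A)r_0,\,T_1(\widehat A)r_0,\dots,T_{s-1}(\widehat A)r_0\bigr]\in\mathbb{R}^{n\times s}.$$ Let $A=V\Lambda V^\top$ be an orthogonal eigendecomposition with $\Lambda=\mathrm{diag}(\lambda_1,\dots,\lambda_n)$, $0<\lambda_1\le\cdots\le\lambda_n$; let $v_\ell$ be the $\ell$th column of $V$, $c_\ell=v_\ell^\top r_0$, and $\widehat\lambda_\ell=(2\lambda_\ell-\lambda_{\max}-\lambda_{\min})/(\lambda_{\max}-\lambda_{\min})\in[-1,1]$. The Gram matrices are $$W^{(0)}:=S_s^\top S_s,\qquad W^{(A)}:=S_s^\top A S_s,$$ and the moments are, for integers $p\ge0$, $$\mu_p^{(0)}:=\sum_{\ell=1}^n|c_\ell|^2T_p(\widehat\lambda_\ell),\qquad \mu_p^{(A)}:=\sum_{\ell=1}^n\lambda_\ell|c_\ell|^2T_p(\widehat\lambda_\ell).$$ *)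

(* Defs.v *)
From mathcomp Require Export all_boot all_order all_algebra.
From mathcomp Require Export reals.

Set Implicit Arguments.
Unset Strict Implicit.
Unset Printing Implicit Defensive.

Import Order.TTheory GRing.Theory Num.Theory.
Local Open Scope ring_scope.

Fixpoint chebT (R : nzRingType) (p : nat) : {poly R} :=
  match p with
  | 0 => 1
  | 1 => 'X
  | (q.+1 as p').+1 => 2%:R *: ('X * chebT R p') - chebT R q
  end.

Definition spsd (R : realType) (m : nat) (M : 'M[R]_m) : Prop :=
  M^T = M /\ forall x : 'cV[R]_m, 0 <= (x^T *m M *m x) 0 0.

Definition spd (R : realType) (m : nat) (M : 'M[R]_m) : Prop :=
  M^T = M /\ forall x : 'cV[R]_m, x != 0 -> 0 < (x^T *m M *m x) 0 0.

(* [horner_mx] needs a dimension of the form n.+1; dimension 0 has no nonzero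
   starting vector. *)
Definition scaled_mx (R : realType) (n : nat) (lmin lmax : R)
    (A : 'M[R]_n.+1) : 'M[R]_n.+1 :=
  (lmax - lmin)^-1 *: (2%:R *: A - (lmax + lmin)%:M).

Definition scaled_eig (R : realType) (lmin lmax lam : R) : R :=
  (2%:R * lam - lmax - lmin) / (lmax - lmin).

(* Column j : 'I_s (counted from 0) is T_j(Ahat) r0. *)
Definition cheb_basis (R : realType) (n s : nat) (lmin lmax : R)
    (A : 'M[R]_n.+1) (r0 : 'cV[R]_n.+1) : 'M[R]_(n.+1, s) :=
  \matrix_(i, j) (horner_mx (scaled_mx lmin lmax A) (chebT R j) *m r0) i 0.

Definition gram0 (R : realType) (n s : nat) (lmin lmax : R)
    (A : 'M[R]_n.+1) (r0 : 'cV[R]_n.+1) : 'M[R]_s :=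
  (cheb_basis s lmin lmax A r0)^T *m cheb_basis s lmin lmax A r0.

Definition gramA (R : realType) (n s : nat) (lmin lmax : R)
    (A : 'M[R]_n.+1) (r0 : 'cV[R]_n.+1) : 'M[R]_s :=
  (cheb_basis s lmin lmax A r0)^T *m A *m cheb_basis s lmin lmax A r0.

Definition orthogonal_eigendecomposition (R : realType) (n : nat)
    (A V : 'M[R]_n) (lam : 'rV[R]_n) : Prop :=
  [/\ V^T *m V = 1%:M,
      A = V *m diag_mx lam *m V^T,
      forall l, 0 < lam 0 l
    & forall k l : 'I_n, (k <= l)%N -> lam 0 k <= lam 0 l].

Definition eigcoef (R : realType) (n : nat) (V : 'M[R]_n) (r0 : 'cV[R]_n)
    (l : 'I_n) : R :=
  ((col l V)^T *m r0) 0 0.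

Definition moment0 (R : realType) (n : nat) (lmin lmax : R)
    (V : 'M[R]_n) (lam : 'rV[R]_n) (r0 : 'cV[R]_n) (p : nat) : R :=
  \sum_(l < n) `|eigcoef V r0 l| ^+ 2
               * (chebT R p).[scaled_eig lmin lmax (lam 0 l)].

Definition momentA (R : realType) (n : nat) (lmin lmax : R)
    (V : 'M[R]_n) (lam : 'rV[R]_n) (r0 : 'cV[R]_n) (p : nat) : R :=
  \sum_(l < n) lam 0 l * `|eigcoef V r0 l| ^+ 2
               * (chebT R p).[scaled_eig lmin lmax (lam 0 l)].

(* Main.v *)
Require Import Defs.
From mathcomp Require Import ring.
Import Order.TTheory GRing.Theory Num.Theory.
Local Open Scope ring_scope.

(** In an orthonormal eigenbasis [V] of [A], every polynomial in [A] acts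
    diagonally, so the Chebyshev basis factors as [V *m C], where row [l] of
    [C] lists the values [T_j(lam^_l) c_l] ([cheb_basisE]).  Any matrix
    [V *m diag_mx w *m V^T] in the middle of a Gram product then collapses to
    the diagonal weight [w], and the [(i, j)] entry is the sum over [l] of
    [w_l c_l^2 T_i(lam^_l) T_j(lam^_l)] ([weighted_gram_entry]).  Taking [w]
    constant equal to [1] gives [gram0], and [w = lam] gives [gramA].  The
    product-to-sum identity [2 T_i T_j = T_(i+j) + T_|i-j|]
    ([chebT_prod_sum]), which mirrors
    [2 cos a cos b = cos (a+b) + cos (a-b)], turns each such sum into the
    average of two moments.

    Definiteness does not involve the eigenbasis: both Gram matrices are
    congruences [S^T *m M *m S] of a positive definite matrix ([M = 1] or
    [M = A]), whose quadratic form at [x] is that of [M] at [S *m x].  It is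
    therefore nonnegative, and it is positive at nonzero [x] as soon as [S] is
    injective ([spd_congr]). *)

Lemma chebTSS (R : nzRingType) (p : nat) :
  chebT R p.+2 = 2%:R *: ('X * chebT R p.+1) - chebT R p.
Proof. by []. Qed.

(** Both sides satisfy the three-term recurrence in [j]: multiplication by
    [2 'X] replaces [T_p] by [T_(p+1) + T_(p-1)], so it shifts the index
    [i + j] and the index [i - j] by one both ways.  The recurrence has order
    two, hence the induction carries two consecutive values of [j], and
    [j <= i] ensures that the truncated [i - j] is the true difference. *)
Lemma chebT_prod_sum_leq (R : comNzRingType) (i j : nat) : (j <= i)%N ->
  2%:R *: (chebT R i * chebT R j) = chebT R (i + j)%N + chebT R (i - j)%N.
Proof.
have recX p : 2%:R *: ('X * chebT R p.+1) = chebT R p.+2 + chebT R p.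
  by rewrite chebTSS subrK.
suff: ((j <= i)%N -> 2%:R *: (chebT R i * chebT R j)
          = chebT R (i + j)%N + chebT R (i - j)%N)
   /\ ((j.+1 <= i)%N -> 2%:R *: (chebT R i * chebT R j.+1)
          = chebT R (i + j.+1)%N + chebT R (i - j.+1)%N) by case.
elim: j => [|j [IH0 IH1]].
  split=> [_|]; first by rewrite addn0 subn0 mulr1 scaler_nat mulr2n.
  case: i => // i _.
  by rewrite addn1 subn1 /= -recX mulrC.
split=> // lt_ji.
have -> : chebT R i * chebT R j.+2
    = 'X * (2%:R *: (chebT R i * chebT R j.+1)) - chebT R i * chebT R j.
  by rewrite chebTSS mulrBr -!scalerAr mulrCA.
rewrite IH1 1?ltnW // scalerBr IH0; last by rewrite 2?ltnW.
rewrite mulrDr scalerDr.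
have [k ->] : exists k, i = (k + j.+2)%N by exists (i - j.+2)%N; rewrite subnK.
have -> : (k + j.+2 - j.+1 = k.+1)%N by rewrite -addSnnS addnK.
have -> : (k + j.+2 - j = k.+2)%N by rewrite -!addSnnS addnK.
by rewrite addnK !addnS !recX; ring.
Qed.

Lemma chebT_prod_sum (R : comNzRingType) (i j : nat) :
  2%:R *: (chebT R i * chebT R j) = chebT R (i + j)%N + chebT R `|i - j|%N.
Proof.
have [le_ji|/ltnW le_ij] := leqP j i.
  by rewrite distnEl // chebT_prod_sum_leq.
by rewrite distnEr // addnC mulrC chebT_prod_sum_leq.
Qed.

Lemma chebT_prod_eval (R : realType) (i j : nat) (x : R) :
  (chebT R i).[x] * (chebT R j).[x]
    = 2%:R^-1 * ((chebT R (i + j)%N).[x] + (chebT R `|i - j|%N).[x]).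
Proof.
rewrite -hornerD -chebT_prod_sum hornerZ hornerM mulrA mulVf ?mul1r //.
by rewrite pnatr_eq0.
Qed.

Lemma horner_mx_orthogonal_conj (R : fieldType) (n : nat) (V : 'M[R]_n.+1)
    (d : 'rV[R]_n.+1) (p : {poly R}) : V^T *m V = 1%:M ->
  horner_mx (V *m diag_mx d *m V^T) p
    = V *m diag_mx (map_mx (horner p) d) *m V^T.
Proof.
move=> VtV; have [_ uV] := mulmx1_unit VtV.
have <- : invmx V = V^T by rewrite -[LHS]mul1mx -VtV mulmxK.
by rewrite horner_mx_uconj // horner_mx_diag.
Qed.

Lemma scaled_mx_eigendecomposition (R : realType) (n : nat) (lmin lmax : R)
    (V : 'M[R]_n.+1) (lam : 'rV[R]_n.+1) : V^T *m V = 1%:M ->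
  scaled_mx lmin lmax (V *m diag_mx lam *m V^T)
    = V *m diag_mx (map_mx (scaled_eig lmin lmax) lam) *m V^T.
Proof.
move=> VtV; have VVt := mulmx1C VtV.
have -> : diag_mx (map_mx (scaled_eig lmin lmax) lam)
    = (lmax - lmin)^-1 *: (2%:R *: diag_mx lam - (lmax + lmin)%:M).
  rewrite -diag_const_mx -!linearZ -linearB -linearZ; congr diag_mx.
  by apply/rowP=> l; rewrite !mxE /scaled_eig mulrC opprD addrA.
rewrite -scalemxAr -scalemxAl mulmxBr mulmxBl -scalemxAr -scalemxAl.
by rewrite mul_mx_scalar -scalemxAl VVt scalemx1.
Qed.

(** Column [j] holds the coordinates of [T_j(A^) r0] in the basis [V]. *)
Definition cheb_coords {R : realType} {n : nat} (s : nat) (lmin lmax : R)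
    (V : 'M[R]_n.+1) (lam : 'rV[R]_n.+1) (r0 : 'cV[R]_n.+1) :
    'M[R]_(n.+1, s) :=
  \matrix_(l, j) ((chebT R j).[scaled_eig lmin lmax (lam 0 l)]
                   * eigcoef V r0 l).

Lemma eigcoefE (R : realType) (n : nat) (V : 'M[R]_n) (r0 : 'cV[R]_n)
    (l : 'I_n) : eigcoef V r0 l = (V^T *m r0) l 0.
Proof. by rewrite /eigcoef tr_col -row_mul mxE. Qed.

Lemma cheb_basisE (R : realType) (n s : nat) (lmin lmax : R)
    (V : 'M[R]_n.+1) (lam : 'rV[R]_n.+1) (r0 : 'cV[R]_n.+1) :
  V^T *m V = 1%:M ->
  cheb_basis s lmin lmax (V *m diag_mx lam *m V^T) r0
    = V *m cheb_coords s lmin lmax V lam r0.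
Proof.
move=> VtV; apply/matrixP=> i j; rewrite mxE.
rewrite scaled_mx_eigendecomposition // horner_mx_orthogonal_conj //.
rewrite -!mulmxA mxE [RHS]mxE; apply: eq_bigr => l _.
by rewrite mul_diag_mx !mxE eigcoefE mxE.
Qed.

(** Orthonormality of [V] cancels both inner factors [V^T *m V], leaving
    [C^T *m diag_mx w *m C] with [C] the coordinate matrix.  The weight [w] is
    free so that the two Gram matrices are instances of one computation. *)
Lemma weighted_gram_entry (R : realType) (n s : nat) (lmin lmax : R)
    (V : 'M[R]_n.+1) (lam w : 'rV[R]_n.+1) (r0 : 'cV[R]_n.+1) (i j : 'I_s) :
  V^T *m V = 1%:M ->
  let S := cheb_basis s lmin lmax (V *m diag_mx lam *m V^T) r0 in
  let T p l := (chebT R p).[scaled_eig lmin lmax (lam 0 l)] in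
  (S^T *m (V *m diag_mx w *m V^T) *m S) i j
    = 2%:R^-1 *
      (\sum_l w 0 l * `|eigcoef V r0 l| ^+ 2 * T (i + j)%N l
       + \sum_l w 0 l * `|eigcoef V r0 l| ^+ 2 * T `|i - j|%N l).
Proof.
move=> VtV S T; rewrite /S cheb_basisE //; set C := cheb_coords _ _ _ _ _ _.
have -> : (V *m C)^T *m (V *m diag_mx w *m V^T) *m (V *m C)
    = C^T *m (diag_mx w *m C).
  rewrite trmx_mul -!mulmxA (mulmxA V^T V C) VtV mul1mx.
  by rewrite (mulmxA V^T V) VtV mul1mx.
rewrite mxE -big_split big_distrr /=; apply: eq_bigr => l _.
rewrite mul_diag_mx !mxE real_normK ?num_real //.
rewrite -mulrDr [RHS]mulrCA /T -chebT_prod_eval.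
by ring.
Qed.

Lemma congr_sym (R : comPzRingType) (m s : nat) (M : 'M[R]_m) (S : 'M[R]_(m, s)) :
  M^T = M -> (S^T *m M *m S)^T = S^T *m M *m S.
Proof. by move=> Msym; rewrite !trmx_mul trmxK Msym mulmxA. Qed.

Lemma congr_quad (R : comPzRingType) (m s : nat) (M : 'M[R]_m)
    (S : 'M[R]_(m, s)) (x : 'cV[R]_s) :
  x^T *m (S^T *m M *m S) *m x = (S *m x)^T *m M *m (S *m x).
Proof. by rewrite trmx_mul !mulmxA. Qed.

Lemma spd_spsd (R : realType) (m : nat) (M : 'M[R]_m) : spd M -> spsd M.
Proof.
case=> Msym Mpos; split=> // x.
have [->|/Mpos/ltW //] := eqVneq x 0.
by rewrite mulmx0 mxE.
Qed.

Lemma spd1 (R : realType) (m : nat) : spd (1%:M : 'M[R]_m).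
Proof.
split=> [|x x0]; first exact: trmx1.
have sq_ge0 i : true -> 0 <= x^T 0 i * x i 0.
  by rewrite mxE -expr2 sqr_ge0.
rewrite mulmx1 mxE lt_def sumr_ge0 // andbT.
apply: contra x0; rewrite psumr_eq0 // => /allP x0.
apply/eqP/colP=> i; rewrite mxE; apply/eqP.
by have := x0 i (mem_index_enum i); rewrite /= mxE mulf_eq0 orbb.
Qed.

Lemma spsd_congr (R : realType) (m s : nat) (M : 'M[R]_m)
    (S : 'M[R]_(m, s)) : spsd M -> spsd (S^T *m M *m S).
Proof.
case=> Msym Mge0; split=> [|x]; first exact: congr_sym.
by rewrite congr_quad.
Qed.

(** Full column rank makes [S] injective, so a nonzero [x] is evaluated by the
    quadratic form of [M] at the nonzero vector [S *m x]. *)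
Lemma spd_congr (R : realType) (m s : nat) (M : 'M[R]_m)
    (S : 'M[R]_(m, s)) : \rank S = s -> spd M -> spd (S^T *m M *m S).
Proof.
move=> rkS [Msym Mpos]; split=> [|x x0]; first exact: congr_sym.
rewrite congr_quad; apply: Mpos; apply: contra x0 => /eqP Sx0.
have freeS : row_free S^T by rewrite /row_free mxrank_tr rkS.
apply/eqP/trmx_inj/(row_free_inj freeS).
by rewrite /= -trmx_mul Sx0 !trmx0 mul0mx.
Qed.

Lemma gram0E (R : realType) (n s : nat) (lmin lmax : R)
    (A : 'M[R]_n.+1) (r0 : 'cV[R]_n.+1) :
  gram0 s lmin lmax A r0
    = (cheb_basis s lmin lmax A r0)^T *m 1%:M *m cheb_basis s lmin lmax A r0.
Proof. by rewrite mulmx1. Qed.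

(* Row and column indices of the Gram matrices start at 0, so the 1-based
   i + j - 2 reads i + j; `|i - j|%N is the absolute difference in nat. *)
Theorem theorem1 (R : realType) (n s : nat) (lmin lmax : R)
    (A : 'M[R]_n.+1) (r0 : 'cV[R]_n.+1)
    (A_spd : spd A)
    (lt_minmax : lmin < lmax)
    (spec_A : forall a : R, eigenvalue A a -> lmin <= a <= lmax)
    (r0_neq0 : r0 != 0)
    (s_ge1 : (1 <= s)%N) :
  [/\ forall (V : 'M[R]_n.+1) (lam : 'rV[R]_n.+1),
        orthogonal_eigendecomposition A V lam ->
        forall i j : 'I_s,
          gram0 s lmin lmax A r0 i j
            = 2%:R^-1 * (moment0 lmin lmax V lam r0 (i + j)%N
                         + moment0 lmin lmax V lam r0 `|i - j|%N)
          /\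
          gramA s lmin lmax A r0 i j
            = 2%:R^-1 * (momentA lmin lmax V lam r0 (i + j)%N
                         + momentA lmin lmax V lam r0 `|i - j|%N),
      spsd (gram0 s lmin lmax A r0) /\ spsd (gramA s lmin lmax A r0)
    & \rank (cheb_basis s lmin lmax A r0) = s ->
      spd (gram0 s lmin lmax A r0) /\ spd (gramA s lmin lmax A r0)].
Proof.
split.
- move=> V lam [VtV -> _ _] i j; split; last exact: weighted_gram_entry.
  (* The identity matrix is diagonal in every orthonormal basis, with weight
     one on each eigenvector. *)
  have one_diag : 1%:M = V *m diag_mx (const_mx 1) *m V^T.
    by rewrite diag_const_mx mulmx1 (mulmx1C VtV).
  rewrite gram0E [in LHS]one_diag weighted_gram_entry //.
  by congr (_ * (_ + _)); apply: eq_bigr => l _; rewrite mxE mul1r.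
- rewrite gram0E; split; apply/spsd_congr/spd_spsd => //.
  exact: spd1.
- move=> rkS; rewrite gram0E; split; apply: spd_congr => //.
  exact: spd1.
Qed.
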